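(* Let $C,\epsilon>0$ be real numbers and let $t\in\mathbb{N}$. Let $n(C,\epsilon,3^t)$ be the minimal $n\in\mathbb{N}$ such that for every $C$-Lipschitz function $f:PS_{\ell_\infty^n}\to\mathbb{R}$ there is a positive block sequence $(\mathbf{y}_i)_{i<3^t}$ in $\ell_\infty^n$ with $$\mathrm{osc}\bigl(f\upharpoonright PS_{[\mathbf{y}_i]_{i<3^t}}\bigr)<\epsilon.$$ Then $$n(C,\epsilon,3^t)<f_3\left(3^{t\cdot s}\left\lceil\frac{9C}{\epsilon}\right\rceil^{3^{t\cdot s}}\left\lceil\log_2\frac{9}{\epsilon}\right\rceil\right),\qquad\text{where } s=\left\lceil\frac{\log(\epsilon/12C)}{\log(1-\epsilon/12C)}\right\rceil+2 .$$
   Context: $\epsilon/12C$ means $\epsilon/(12C)$. $\mathbb{N}$ starts at $0$. The function $f_3:\mathbb{N}\to\mathbb{N}$ (TOWER) is the third function of the Ackermann hierarchy: $f_1(x)=2x$ and $f_{i+1}(x)=f_i^{(x)}(1)$, where $f_i^{(x)}$ is the $x$-fold iterate of $f_i$. $\ell_\infty^n$ is $\mathbb{R}^n$ with the sup norm and its standard basis $(\mathbf{e}_i)_{i<n}$. The support of $\mathbf{x}=\sum_{i<n}a_i\mathbf{e}_i$ is $\mathrm{supp}(\mathbf{x})=\{i<n:a_i\ne 0\}$, and $\mathbf{x}$ is positive if every $a_i\ge 0$. A positive block sequence $(\mathbf{y}_i)_{i<m}$ is a sequence of nonzero positive vectors with $\max\mathrm{supp}(\mathbf{y}_i)<\min\mathrm{supp}(\mathbf{y}_j)$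 for all $i<j<m$. $[\mathbf{y}_i]_{i<m}$ denotes the linear span of $(\mathbf{y}_i)_{i<m}$. For a subspace $Y$ of $\ell_\infty^n$ generated by a positive block sequence (including $Y=\ell_\infty^n$ itself), $PS_Y$ is the positive unit sphere of $Y$, i.e. the set of positive vectors of norm $1$ in $Y$. $C$-Lipschitz is with respect to the sup norm. For a real-valued function $f$ and a subset $A$ of its domain, $\mathrm{osc}(f\upharpoonright A)=\sup\{|f(\mathbf{x})-f(\mathbf{y})|:\mathbf{x},\mathbf{y}\in A\}$.
   Formalization: The formal theorem assumes ε < 9: for 9 ≤ ε < 18 the argument of f_3 is 0, so the bound is f_3(0) = 1 although n(C,ε,3^t) ≥ 3^t ≥ 1, and for ε ≥ 18 the argument is negative; when ε ≥ 12C, where s is undefined, s is taken to be 2. *)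

(* Defs.v *)
From HB Require Import structures.
From mathcomp Require Import all_boot all_order all_algebra.
From mathcomp Require Import all_classical all_reals all_analysis.
Set Implicit Arguments.
Unset Strict Implicit.
Unset Printing Implicit Defensive.
Import Order.TTheory GRing.Theory Num.Theory.
Import numFieldNormedType.Exports.
Local Open Scope classical_set_scope.
Local Open Scope ring_scope.

(* The hierarchy is indexed from 1, as in f_1(x) = 2x; the value at index 0
   is a convention that is never used. *)
Fixpoint f_ (i : nat) : nat -> nat :=
  match i with
  | (_.+1 as j).+1 => fun x => iter x (f_ j) 1%N
  | _ => fun x => (2 * x)%N
  end.

(* The integer ceiling of x as a natural number; this is the usual ceiling
   only when x > -1. *)
Definition nceil (R : realType) (x : R) : nat := `|Num.ceil x|%N.

Definition log2 (R : realType) (x : R) : R := ln x / ln 2.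

(* l_oo^n is 'rV[R]_n with the norm of MathComp-Analysis, which is the sup norm
   (mx_normrE); the standard basis vector e_i is delta_mx 0 i. *)

Definition supp (R : realType) (n : nat) (x : 'rV[R]_n) : {set 'I_n} :=
  [set i | x 0 i != 0]%SET.

Definition positive_vec (R : realType) (n : nat) (x : 'rV[R]_n) : Prop :=
  forall i, 0 <= x 0 i.

(* As the supports are nonempty, max supp y_i < min supp y_j means that every
   element of supp y_i is smaller than every element of supp y_j. *)
Definition positive_block_seq (R : realType) (n m : nat)
    (y : m.-tuple 'rV[R]_n) : Prop :=
  (forall i, tnth y i != 0 /\ positive_vec (tnth y i)) /\
  (forall i j : 'I_m, (i < j)%N ->
     forall k l : 'I_n, k \in supp (tnth y i) -> l \in supp (tnth y j) ->
     (k < l)%N).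

Definition PS (R : realType) (n : nat) (Y : {vspace 'rV[R]_n}) :
    set 'rV[R]_n :=
  [set x | [/\ x \in Y, positive_vec x & `|x| = 1]].

Definition osc (R : realType) (T : Type) (f : T -> R) (A : set T) : \bar R :=
  ereal_sup [set e | exists x y, [/\ A x, A y & e = `|f x - f y|%:E]].

(* Functions on PS_(l_oo^n) are represented by total functions, of which only
   the values on PS fullv matter. *)
Definition osc_stable (R : realType) (C eps : R) (m n : nat) : Prop :=
  forall f : 'rV[R]_n -> R, C.-lipschitz_(PS fullv) f ->
  exists y : m.-tuple 'rV[R]_n,
    positive_block_seq y /\ (osc f (PS <<y>>%VS) < eps%:E)%E.

Definition is_minimal_nat (P : nat -> Prop) (n : nat) : Prop :=
  P n /\ forall k, P k -> (n <= k)%N.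

(* Meaningful for eps < 12 * C; when 12 * C <= eps the denominator is ln of a
   nonpositive real, that is 0, and the value is 2. *)
Definition s_of (R : realType) (C eps : R) : nat :=
  (nceil (ln (eps / (12 * C)) / ln (1 - eps / (12 * C))) + 2)%N.

(* Main.v *)
Require Import Defs.
From HB Require Import structures.
From mathcomp Require Import all_boot all_order all_algebra.
From mathcomp Require Import all_classical all_reals all_analysis.
From mathcomp Require Import zify ring lra.
Set Implicit Arguments.
Unset Strict Implicit.
Unset Printing Implicit Defensive.
Import Order.TTheory GRing.Theory Num.Theory.
Import numFieldNormedType.Exports.

(** Round the coordinates of a vector to the levels (1 - 1/D)^j, so that a
    vector of the positive sphere becomes a word over the heights 0, ..., k
    (0 being the coordinate 0, k the coordinate 1).  Ramsey's theorem for
    subsets of bounded size gives a set of positions on which f depends, up to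
    C/D, only on the sequence of nonzero letters of the word.  Take for y_i
    copies of one self-similar word Z_k, Z_(h+1) = Z_h (h+1) Z_h (h+1) Z_h.
    Lowering all heights by j, which amounts to multiplying by (1 - 1/D)^j,
    turns Z_k into Z_(k-j), so a vector of the span is a word
    Z_(h_1) ... Z_(h_m) in which some h_i is k.  Moving each letter by at most
    one level turns Z_h Z_h into Z_(h+1), and Z_(h+1) into Z_h; since Z_h is a
    prefix and a suffix of Z_k, the factor Z_k absorbs its neighbours one after
    the other at a cost O(C/D) each, so the value of f is always close to the
    one at Z_k.  With D of order m C / eps and k = D^2, the Ramsey number is a
    tower whose height is of order 3^(3k), far below r^(3^(t s)). *)

(** * Ramsey's theorem for lists *)

Lemma pigeonhole_seq (T : eqType) (K : finType) (c : T -> K) (s : seq T) n :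
  (#|K| * n < size s) -> exists i, (n < count (fun x => c x == i) s).
Proof.
move=> lt_s; apply/existsP; apply: contraLR lt_s => /existsPn lt_n.
have -> : size s = (\sum_(i : K) count (fun x => c x == i) s).
  elim: s {lt_n} => [|x s IHs] /=; first by rewrite big1.
  rewrite big_split /= -IHs (bigD1 (c x)) //= eqxx big1 // => i.
  by rewrite eq_sym => /negPf ->.
rewrite -leqNgt -sum_nat_const; apply: leq_sum => i _.
by rewrite leqNgt lt_n.
Qed.

(** Passing to the largest colour class of singletons costs the factor [kappa]; colouring the rest
    by pairs squares the number of colours. *)
Fixpoint end_homog_bound (kappa p : nat) : nat :=
  if p is p'.+1 then (kappa * end_homog_bound (kappa * kappa) p').+1 else 0.

(* The first element [x] is kept and the rest is refined with respect to the pair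
   of colourings of [u] and of [x :: u]. *)
Lemma end_homogeneous (T : eqType) (p : nat) : forall (K : finType)
    (c : seq T -> K) (s : seq T), (0 < #|K|) ->
  (end_homog_bound #|K| p <= size s) ->
  exists2 h : seq T, subseq h s & size h = p /\
    forall u y z, subseq (rcons u y) h -> subseq (rcons u z) h ->
      c (rcons u y) = c (rcons u z).
Proof.
elim: p => [|p IHp] K c s K_gt0 /=.
  by move=> _; exists [::]; rewrite ?sub0seq //; split=> // u y z; case: u.
move=> le_s; have [i] := pigeonhole_seq (fun x => c [:: x]) le_s.
rewrite -size_filter.
case def_s1: [seq x <- s | c [:: x] == i] => [|x s1] //= lt_s1.
have [h hs1 [size_h hom_h]] :
    exists2 h : seq T, subseq h s1 & size h = p /\
    forall u y z, subseq (rcons u y) h -> subseq (rcons u z) h ->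
      (c (rcons u y), c (x :: rcons u y)) = (c (rcons u z), c (x :: rcons u z)).
  by apply: (IHp (K * K)%type (fun u => (c u, c (x :: u)))); rewrite card_prod ?muln_gt0 ?K_gt0.
have sub_h : subseq (x :: h) [seq x <- s | c [:: x] == i].
  by rewrite def_s1 /= eqxx.
exists (x :: h); first exact: subseq_trans sub_h (filter_subseq _ _).
(* If [u] is empty, both colours are [i] by the choice of the class. Otherwise the second component
   of the pair serves when [u] starts with [x], the first when it does not. *)
split=> [|[|a u] y z]; first by rewrite /= size_h.
  move=> /(subseq_trans)/(_ sub_h) + /(subseq_trans)/(_ sub_h).
  by rewrite !sub1seq !mem_filter => /andP[/eqP-> _] /andP[/eqP-> _].
rewrite !rcons_cons /=; case: eqP => [->|_] huy huz.
  by have [] := hom_h _ _ _ huy huz.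
rewrite -!rcons_cons in huy huz *.
by have [] := hom_h _ _ _ huy huz.
Qed.

Fixpoint ramsey_bound (kappa q M : nat) : nat :=
  if q is q'.+1 then end_homog_bound kappa (ramsey_bound kappa q' M) else M.

(** Induction on [q]: on an end-homogeneous list the colour does not depend on the last element, so
    [c] induces a colouring of sublists with one element less. *)
Lemma ramsey_seq (T : eqType) (K : finType) (q M : nat) :
  (0 < #|K|) -> forall (c : seq T -> K) (s : seq T),
  (ramsey_bound #|K| q M <= size s) ->
  exists2 h : seq T, subseq h s & size h = M /\
    forall u v, subseq u h -> subseq v h -> size u = q -> size v = q ->
      c u = c v.
Proof.
move=> K_gt0; elim: q => [|q IHq] c s le_s.
  exists (take M s); first exact: take_subseq.
  by rewrite size_takel //; split=> // u v _ _ /size0nil-> /size0nil->.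
have [h0 h0s [size_h0 hom_h0]] := end_homogeneous c K_gt0 le_s.
(* Any continuation of [u] gives the same colour; [c u] is a default for those [u] that have
   none. *)
pose c' u := if [seq y <- h0 | subseq (rcons u y) h0] is y :: _
             then c (rcons u y) else c u.
have [|h hh0 [size_h hom_h]] := IHq c' h0; first by rewrite size_h0.
have c'E u y : subseq (rcons u y) h -> c' u = c (rcons u y).
  move=> /subseq_trans/(_ hh0) uy; rewrite /c'.
  have := mem_filter (fun y => subseq (rcons u y) h0) ^~ h0.
  case: seq.filter => [/(_ y)|z l /(_ z)].
    by rewrite uy (mem_subseq uy) // mem_rcons inE eqxx.
  by rewrite inE eqxx => /esym/andP[uz _]; apply: hom_h0.
exists h; first exact: subseq_trans hh0 h0s.
split=> // u v; case/lastP: u => // u y; case/lastP: v => // v z uh vh.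
rewrite !size_rcons => -[size_u] [size_v].
rewrite -(c'E _ _ uh) -(c'E _ _ vh).
by apply: hom_h => //; [move: uh | move: vh]; apply: subseq_trans; apply: subseq_rcons.
Qed.

(** * Tower bounds for the Ramsey numbers *)

Lemma end_homog_bound_lt kappa p : (1 < kappa) ->
  (end_homog_bound kappa p < kappa ^ 2 ^ p).
Proof.
(* The exponent 2^p - 1 carries the induction: squaring [kappa] doubles it and the extra factor
   [kappa] adds one. *)
suff bnd : (1 < kappa -> end_homog_bound kappa p < kappa ^ (2 ^ p).-1).
  move=> k_gt1; apply: leq_trans (bnd k_gt1) _.
  by rewrite leq_exp2l // leq_pred.
elim: p kappa => [|p IHp] kappa k_gt1 //=.
have k2_gt1 : (1 < kappa * kappa) by nia.
have := IHp _ k2_gt1; rewrite mulnn -expnM.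
have -> : (2 ^ p.+1).-1 = (2 * (2 ^ p).-1).+1.
  by rewrite expnS; have := expn_gt0 2 p; lia.
rewrite [in X in _ -> X](expnS kappa (2 * _)).
move: (end_homog_bound _ _) (kappa ^ (2 * _)) => e w lt_ew.
have : (kappa * e.+1 <= kappa * w) by rewrite leq_mul2l lt_ew orbT.
by rewrite mulnS; lia.
Qed.

Definition tower (h x : nat) : nat := iter h (expn 2) x.

Lemma leq_tower h x y : (x <= y) -> (tower h x <= tower h y).
Proof. by move=> le_xy; elim: h => //= h IHh; rewrite leq_exp2l. Qed.

Lemma leq_tower_addl h x : (x + h <= tower h x).
Proof.
elim: h => [|h IHh] /=; first by rewrite addn0.
by rewrite addnS; apply: leq_ltn_trans IHh (ltn_expl _ _).
Qed.

(** The top entry [x] is itself below a tower of [x] twos. *)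
Lemma tower1_ge h x : (tower h x <= tower (h + x) 1).
Proof.
rewrite /tower iterD; apply: leq_tower.
by apply: leq_trans (leq_tower_addl x 1); rewrite leq_addl.
Qed.

Lemma tower1_gt h : (h < tower h 1).
Proof. by have := leq_tower_addl h 1. Qed.

Lemma leq_tower1 h1 h2 : (h1 <= h2) -> (tower h1 1 <= tower h2 1).
Proof.
move=> /subnKC <-; rewrite /tower iterD; apply: leq_tower.
by apply: leq_ltn_trans (leq0n _) (tower1_gt _).
Qed.

Lemma ltn_tower1 h1 h2 : (h1 < h2) -> (tower h1 1 < tower h2 1).
Proof.
move=> lt_h; apply: leq_trans (leq_tower1 lt_h).
by rewrite /tower /= ltn_expl.
Qed.

(** One Ramsey step is at most doubly exponential in N + b, N being the previous bound; three levels
    of the tower are allotted to it. *)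
Lemma ramsey_bound_le kappa b q M : (1 < kappa <= 2 ^ b) ->
  (ramsey_bound kappa q M <= tower (3 * q) (M + b).+1).
Proof.
case/andP=> k_gt1 k_le.
(* Keeping [b] in the sum lets each step absorb the number of colours again. *)
suff: (ramsey_bound kappa q M + b < tower (3 * q) (M + b).+1) by lia.
elim: q => [|q IHq]; first by rewrite muln0.
have -> : (3 * q.+1 = (3 * q).+3) by lia.
rewrite /tower !iterS -/(tower _ _) [ramsey_bound _ _ _]/=; set N := ramsey_bound kappa q M in IHq *.
set t := tower _ _ in IHq *.
have lt1 := end_homog_bound_lt N k_gt1.
have le2 : (kappa ^ 2 ^ N <= 2 ^ (b * 2 ^ N)).
  by rewrite expnM leq_exp2r ?expn_gt0.
have le3 : (b * 2 ^ N <= 2 ^ (N + b)).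
  rewrite expnD mulnC leq_mul2l ltnW ?orbT //; exact: ltn_expl.
have le4 : (2 ^ (b * 2 ^ N) <= 2 ^ 2 ^ (N + b)) by rewrite leq_exp2l.
have le5 : (2 ^ 2 ^ (N + b).+1 <= 2 ^ 2 ^ 2 ^ t).
  rewrite !leq_exp2l //; apply: leq_trans IHq _; exact/ltnW/ltn_expl.
apply: leq_trans le5.
have b_lt : (b <= 2 ^ 2 ^ (N + b)).
  apply: (@leq_trans (2 ^ (N + b))); last exact/ltnW/ltn_expl.
  by apply: (@leq_trans (N + b)); [exact: leq_addl | exact/ltnW/ltn_expl].
rewrite expnS mul2n -addnn expnD.
have : (1 < 2 ^ 2 ^ (N + b)).
  by rewrite -[X in (X < _)](expn0 2) ltn_exp2l // expn_gt0.
set w := (2 ^ 2 ^ (N + b)) in le4 b_lt *.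
move: lt1 le2; set e := end_homog_bound _ _ => lt1 le2 w_gt1.
have : (2 * w <= w * w) by rewrite leq_mul2r w_gt1 orbT.
by lia.
Qed.

(** * Self-similar words *)

Definition letters (w : seq nat) : seq nat := [seq a <- w | 0 < a].

Definition adj_letter (a b : nat) : bool := (a <= b.+1) && (b <= a.+1).

(* Zero letters, which stand for vanishing coordinates, may be inserted and
   deleted freely. *)
Definition wclose (w w' : seq nat) : Prop :=
  exists u u', [/\ letters u = letters w, letters u' = letters w' &
                   all2 adj_letter u u'].

Lemma letters_cat u v : letters (u ++ v) = letters u ++ letters v.
Proof. exact: filter_cat. Qed.

Lemma size_letters u : size (letters u) <= size u.
Proof. by rewrite size_filter count_size. Qed.

Lemma mem_letters a w : 0 < a -> (a \in letters w) = (a \in w).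
Proof. by move=> a_gt0; rewrite mem_filter a_gt0. Qed.

Lemma all_letters (k : nat) w :
  all (leq^~ k) (letters w) = all (leq^~ k) w.
Proof. by elim: w => //= -[|a] w /= ->. Qed.

Lemma all2_adj_letterxx w : all2 adj_letter w w.
Proof. by elim: w => //= a w ->; rewrite /adj_letter leqnSn. Qed.

Lemma wclose_refl w : wclose w w.
Proof. by exists w, w; split=> //; apply: all2_adj_letterxx. Qed.

Lemma wclose_cat w1 w1' w2 w2' :
  wclose w1 w1' -> wclose w2 w2' -> wclose (w1 ++ w2) (w1' ++ w2').
Proof.
move=> [u1 [u1' [e1 e1' a1]]] [u2 [u2' [e2 e2' a2]]].
exists (u1 ++ u2), (u1' ++ u2'); split; rewrite ?letters_cat ?e1 ?e2 ?e1' ?e2' //.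
by elim: u1 u1' {e1 e1'} a1 => [|a u IHu] [|b u'] //= /andP[-> /IHu].
Qed.

Lemma wclose_cons a b w w' :
  adj_letter a b -> wclose w w' -> wclose (a :: w) (b :: w').
Proof.
move=> ab; apply: (@wclose_cat [:: a] [:: b]).
by exists [:: a], [:: b]; rewrite /= ab.
Qed.

Lemma wclose_ctx x z w w' : wclose w w' -> wclose (x ++ w ++ z) (x ++ w' ++ z).
Proof.
move=> ww'; apply: wclose_cat (wclose_refl x) _.
exact: wclose_cat ww' (wclose_refl z).
Qed.

Lemma wclose_flatten (T : eqType) (F G : T -> seq nat) (s : seq T) :
  {in s, forall x, wclose (F x) (G x)} ->
  wclose (flatten (map F s)) (flatten (map G s)).
Proof.
elim: s => [|x s IHs] FG /=; first exact: wclose_refl.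
apply: wclose_cat; first by apply: FG; rewrite mem_head.
by apply: IHs => y ys; apply: FG; rewrite inE ys orbT.
Qed.

(** Dropping the places where both words have a zero leaves at most one place per nonzero letter of
    either word. The bound ensures that the padded words fit on a fixed set of positions. *)
Lemma wclose_padding w w' : wclose w w' ->
  exists u u', [/\ letters u = letters w, letters u' = letters w',
    all2 adj_letter u u' & size u <= size w + size w'].
Proof.
move=> [u [u' [eu eu' uu']]].
have [v [v' [ev ev' vv' sz]]] : exists v v', [/\ letters v = letters u,
    letters v' = letters u', all2 adj_letter v v'
    & size v <= size (letters u) + size (letters u')].
  elim: u u' {eu eu'} uu' => [|a u IHu] [|b u'] //= uu'; first by exists [::], [::].
  have /andP[ab {}/IHu[v [v' [ev ev' vv' sz]]]] := uu'.
  have [/andP[/eqP-> /eqP->]|ab0] := boolP ((a == 0) && (b == 0)).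
    by exists v, v'.
  exists (a :: v), (b :: v'); rewrite /= ev ev' ab vv'; split=> //.
  by case: (a) (b) ab0 => [|a'] [|b'] //= _; lia.
exists v, v'; split; rewrite ?ev ?ev' //.
apply: leq_trans sz _; rewrite eu eu'.
by apply: leq_add; apply: size_letters.
Qed.

(* Zimin words have one top letter; with two of them there is enough room for
   [zimin h ++ zimin h] to be close to [zimin h.+1]. *)
Fixpoint zimin (h : nat) : seq nat :=
  if h is h'.+1 then zimin h' ++ h :: zimin h' ++ h :: zimin h' else [::].

Lemma size_zimin h : (size (zimin h)).+1 = 3 ^ h.
Proof.
by elim: h => //= h IHh; rewrite expnS -IHh size_cat /= size_cat /=; lia.
Qed.

Lemma zimin_le h : all (leq^~ h) (zimin h).
Proof.
elim: h => //= h IHh.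
have IHh' : all (leq^~ h.+1) (zimin h).
  by apply: sub_all IHh => a /= /leqW.
by rewrite all_cat /= all_cat /= leqnn IHh'.
Qed.

Lemma letters_zimin h : letters (zimin h) = zimin h.
Proof. by elim: h => //= h IHh; rewrite letters_cat /= letters_cat /= IHh. Qed.

(** Lowering commutes with the recursion, and all letters of the base [zimin d] are at most [d], so
    they become zeros. *)
Lemma letters_shift d h : letters [seq a - d | a <- zimin (h + d)] = zimin h.
Proof.
elim: h => [|h IHh].
  have := zimin_le d; elim: (zimin d) => //= a w IHw /andP[ad /IHw].
  by rewrite (eqP ad).
rewrite addSn /= !(map_cat, letters_cat, map_cons) /= subSn ?leq_addl //= addnK.
by rewrite letters_cat /= IHh.
Qed.

Lemma wclose_zimin_pred h : wclose (zimin h.+1) (zimin h).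
Proof.
exists (zimin h.+1), [seq a - 1 | a <- zimin h.+1]; split=> //.
  by have := letters_shift 1 h; rewrite addn1 letters_zimin.
elim: (zimin _) => //= a w ->.
by rewrite /adj_letter; lia.
Qed.

Lemma wclose_sym w w' : wclose w w' -> wclose w' w.
Proof.
move=> [u [u' [eu eu' uu']]]; exists u', u; split=> //.
elim: u u' uu' {eu eu'} => [|a u IHu] [|b u'] //= /andP[ab /IHu->].
by rewrite andbT /adj_letter andbC.
Qed.

(** Induction: in the last factor [zimin h.+1] the first letter h + 1 is promoted to the missing h +
    2. The [zimin h] before it rises by one level, and what follows it is the same claim one height
    lower. *)
Lemma wclose_zimin_half h : wclose (zimin h ++ h.+1 :: zimin h) (zimin h.+1).
Proof.
elim: h => [|h IHh]; first by exists [:: 1; 0], [:: 1; 1].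
rewrite [zimin h.+2]/= -/(zimin h.+1).
apply: wclose_cat; first exact: wclose_refl.
apply: wclose_cons; first by rewrite /adj_letter leqnSn.
apply: (@wclose_cat (zimin h) _ (h.+1 :: zimin h ++ h.+1 :: zimin h)).
  exact/wclose_sym/wclose_zimin_pred.
by apply: wclose_cons => //; rewrite /adj_letter; lia.
Qed.

(** The double word has four letters h + 1. The two inner ones are promoted to h + 2; the outer
    pieces are then handled by [wclose_zimin_half], the middle one by induction. *)
Lemma wclose_zimin_double h : wclose (zimin h ++ zimin h) (zimin h.+1).
Proof.
elim: h => [|h IHh]; first by exists [:: 0; 0], [:: 1; 1].
have -> : zimin h.+1 ++ zimin h.+1 =
    (zimin h ++ h.+1 :: zimin h) ++ h.+1 :: (zimin h ++ zimin h) ++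
    h.+1 :: (zimin h ++ h.+1 :: zimin h).
  by rewrite /= -!catA /= -!catA.
have adj_h : adj_letter h.+1 h.+2 by rewrite /adj_letter; lia.
rewrite [zimin h.+2]/= -/(zimin h.+1).
apply: wclose_cat; first exact: wclose_zimin_half.
apply: wclose_cons => //; apply: wclose_cat => //.
by apply: wclose_cons => //; apply: wclose_zimin_half.
Qed.

Lemma zimin_top h : h.+1 \in zimin h.+1.
Proof. by rewrite /= mem_cat mem_head orbT. Qed.

(** A letter [k] survives outside the suffix, so the word stays admissible while the suffix is
    altered. *)
Lemma zimin_suffix h k : h < k ->
  exists2 x, zimin k = x ++ zimin h & k \in x.
Proof.
elim: k => // k IHk; rewrite ltnS leq_eqVlt => /predU1P[->|/IHk[x ex _]].
  exists (zimin k ++ k.+1 :: zimin k ++ [:: k.+1]).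
    by rewrite /= -!catA /= -!catA.
  by rewrite mem_cat mem_head orbT.
exists (zimin k ++ k.+1 :: zimin k ++ k.+1 :: x).
  by rewrite /= {3}ex -!catA /= -!catA.
by rewrite mem_cat mem_head orbT.
Qed.

Lemma zimin_prefix h k : h < k ->
  exists2 x, zimin k = zimin h ++ x & k \in x.
Proof.
elim: k => // k IHk; rewrite ltnS leq_eqVlt => /predU1P[->|/IHk[x ex _]].
  by exists (k.+1 :: zimin k ++ k.+1 :: zimin k); rewrite ?mem_head.
exists (x ++ k.+1 :: zimin k ++ k.+1 :: zimin k).
  by rewrite /= {1}ex -!catA.
by rewrite mem_cat mem_head orbT.
Qed.

(** * Absorption of the neighbours of a top factor *)

Local Open Scope ring_scope.

(** The letter [k] stands for the coordinate 1 and gives the placed vector norm 1; [B] is the number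
    of available positions. *)
Definition admissible (k B : nat) (w : seq nat) : bool :=
  [&& all (leq^~ k) w, k \in w & (size w <= B)%N].

Lemma zimin_leq h k : (h <= k)%N -> all (leq^~ k) (zimin h).
Proof. by move=> hk; apply: sub_all (zimin_le h) => a /leq_trans/(_ hk). Qed.

Lemma size_flatten_zimin k hs : all (leq^~ k) hs ->
  (size (flatten (map zimin hs)) <= size hs * 3 ^ k)%N.
Proof.
elim: hs => //= h hs IHs /andP[hk /IHs]; rewrite size_cat mulSn.
have : (3 ^ h <= 3 ^ k)%N by rewrite leq_exp2l.
by have := size_zimin h; lia.
Qed.

Lemma flatten_zimin_leq k hs : all (leq^~ k) hs ->
  all (leq^~ k) (flatten (map zimin hs)).
Proof.
elim: hs => //= h hs IHs /andP[hk /IHs]; rewrite all_cat => ->.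
by rewrite zimin_leq.
Qed.

Section Chain.
Variables (R : numDomainType) (G : seq nat -> R) (E : R) (k B : nat).
Hypothesis G_wclose : forall w w', wclose w w' ->
  admissible k B w -> admissible k B w' -> `|G w - G w'| <= E.

(** Two moves, each of cost [E]: up from the double word to [zimin h.+1], then down to [zimin h]. *)
Lemma absorb_close x z h : (h < k)%N -> all (leq^~ k) x -> all (leq^~ k) z ->
    k \in x ++ z -> (size x + size z + 3 ^ h.+1 <= B)%N ->
  `|G (x ++ (zimin h ++ zimin h) ++ z) - G (x ++ zimin h ++ z)| <= E *+ 2.
Proof.
move=> hk xk zk kxz szB.
have adm y : all (leq^~ k) y -> (size y < 3 ^ h.+1)%N ->
    admissible k B (x ++ y ++ z).
  move=> yk szy; rewrite /admissible !all_cat xk yk zk /= !size_cat.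
  apply/andP; split; last by lia.
  by move: kxz; rewrite !mem_cat => /orP[] ->; rewrite ?orbT.
have szh := size_zimin h; have szh1 := size_zimin h.+1.
have pow : (3 ^ h.+1 = 3 * 3 ^ h)%N by rewrite expnS.
rewrite -[_ - _](subrKA (G (x ++ zimin h.+1 ++ z))) mulr2n.
apply: le_trans (ler_normD _ _) (lerD _ _); apply: G_wclose.
- exact/wclose_ctx/wclose_zimin_double.
- apply: adm; last by rewrite size_cat; lia.
  by rewrite all_cat !zimin_leq // ltnW.
- by apply: adm; [apply: zimin_leq | lia].
- exact/wclose_ctx/wclose_zimin_pred.
- by apply: adm; [apply: zimin_leq | lia].
- by apply: adm; [apply/zimin_leq/ltnW | lia].
Qed.

(** A neighbour [zimin h] doubles the suffix [zimin h] of [zimin k], so [absorb_close] removes it.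
    Strictness h < k keeps [zimin h.+1] within the heights up to [k]. *)
Lemma absorb_right x hs : all (ltn^~ k) hs -> all (leq^~ k) x ->
    (size x + (size hs).+1 * 3 ^ k <= B)%N ->
  `|G (x ++ zimin k ++ flatten (map zimin hs)) - G (x ++ zimin k)|
     <= E *+ (2 * size hs).
Proof.
move=> hsk xk; elim: hs hsk => [|h hs IHs] /=.
  by rewrite cats0 subrr normr0.
move=> /andP[hk hsk] szB; rewrite mulnS mulrnDr.
rewrite -[_ - _](subrKA (G (x ++ zimin k ++ flatten (map zimin hs)))).
apply: le_trans (ler_normD _ _) (lerD _ (IHs _ _)) => //; last by lia.
have hsk' : all (leq^~ k) hs by apply: sub_all hsk => a /ltnW.
have [y ey ky] := zimin_suffix hk.
have := @absorb_close (x ++ y) (flatten (map zimin hs)) h hk.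
rewrite -!catA !(catA y) -ey; apply.
- by have := zimin_leq (leqnn k); rewrite ey !all_cat xk => /andP[->].
- exact: flatten_zimin_leq.
- by rewrite !mem_cat ky orbT.
have := size_flatten_zimin hsk'; have := size_zimin k.
rewrite {1}ey !size_cat.
have := size_zimin h; have : (3 ^ h.+1 <= 3 ^ k)%N by rewrite leq_exp2l.
rewrite expnS; lia.
Qed.

Lemma absorb_left hs : all (ltn^~ k) hs -> ((size hs).+1 * 3 ^ k <= B)%N ->
  `|G (flatten (map zimin hs) ++ zimin k) - G (zimin k)| <= E *+ (2 * size hs).
Proof.
elim/last_ind: hs => [|hs h IHs]; first by rewrite subrr normr0.
rewrite all_rcons size_rcons => /andP[hk hsk] szB; rewrite mulnS mulrnDr.
rewrite -[_ - _](subrKA (G (flatten (map zimin hs) ++ zimin k))).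
apply: le_trans (ler_normD _ _) (lerD _ (IHs _ _)) => //; last by lia.
have hsk' : all (leq^~ k) hs by apply: sub_all hsk => a /ltnW.
have [y ey ky] := zimin_prefix hk.
have := @absorb_close (flatten (map zimin hs)) y h hk.
rewrite map_rcons flatten_rcons -!catA -ey; apply.
- exact: flatten_zimin_leq.
- by have := zimin_leq (leqnn k); rewrite ey !all_cat => /andP[].
- by rewrite !mem_cat ky orbT.
have := size_flatten_zimin hsk'; have := size_zimin k.
rewrite {1}ey !size_cat.
have := size_zimin h; have : (3 ^ h.+1 <= 3 ^ k)%N by rewrite leq_exp2l.
rewrite expnS; lia.
Qed.

Lemma wclose_top hs : (0 < k)%N -> all (leq^~ k) hs -> k \in hs ->
    (size hs * 3 ^ k <= B)%N ->
  `|G (flatten (map zimin hs)) - G (zimin k)| <= E *+ (2 * size hs).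
Proof.
move=> k_gt0 + /splitPr hsk; case: hsk => s1 s2.
rewrite all_cat /= => /and3P[s1k _ s2k]; rewrite size_cat /= => szB.
(* All factors [zimin k] except the chosen one are lowered to [zimin k.-1] in a single move of cost
   [E], which gives the strict bounds needed for absorption. *)
pose low := minn k.-1; pose lw s := flatten (map zimin (map low s)).
have low_lt s : all (ltn^~ k) (map low s).
  by rewrite all_map; apply/allP => a _ /=; rewrite /low; lia.
have low_le s : all (leq^~ k) (map low s).
  by apply: sub_all (low_lt s) => a /ltnW.
have wclose_low s : all (leq^~ k) s -> wclose (flatten (map zimin s)) (lw s).
  move=> sk; rewrite /lw -map_comp; apply: wclose_flatten => a /(allP sk) /=.
  rewrite leq_eqVlt => /predU1P[->|ak]; last first.
    by have -> : low a = a; [rewrite /low; lia | apply: wclose_refl].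
  have -> : low k = k.-1 by rewrite /low; lia.
  by rewrite -{1}(prednK k_gt0); apply: wclose_zimin_pred.
have kz : k \in zimin k by rewrite -(prednK k_gt0) zimin_top.
have szk := size_zimin k.
have := size_flatten_zimin s1k; have := size_flatten_zimin s2k.
have := size_flatten_zimin (low_le s1); have := size_flatten_zimin (low_le s2).
rewrite !size_map -!/(lw _) => sz2' sz1' sz2 sz1.
have step1 : `|G (flatten (map zimin (s1 ++ k :: s2))) -
               G (lw s1 ++ zimin k ++ lw s2)| <= E.
  rewrite map_cat flatten_cat /=.
  apply: G_wclose.
  - apply: wclose_cat (wclose_low _ s1k) _.
    exact: wclose_cat (wclose_refl _) (wclose_low _ s2k).
  - rewrite /admissible !all_cat !flatten_zimin_leq // zimin_leq //.
    by rewrite !mem_cat kz orbT /= !size_cat; lia.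
  - rewrite /admissible !all_cat !flatten_zimin_leq // zimin_leq //.
    by rewrite !mem_cat kz orbT /= !size_cat; lia.
have step2 := @absorb_right (lw s1) (map low s2) (low_lt s2)
  (flatten_zimin_leq (low_le s1)).
have step3 := absorb_left (low_lt s1).
rewrite size_map in step2; rewrite size_map in step3.
have E_ge0 : 0 <= E by apply: le_trans step1.
apply: (@le_trans _ _ (E + (E *+ (2 * size s2) + E *+ (2 * size s1)))); last first.
  rewrite -mulrnDr -mulrS; apply: ler_wpMn2l => //; by rewrite -mulnDr addnS ltn_pmul2l // addnC.
rewrite -[_ - _](subrKA (G (lw s1 ++ zimin k ++ lw s2))).
apply: le_trans (ler_normD _ _) (lerD step1 _).
rewrite -[_ - _](subrKA (G (lw s1 ++ zimin k))).
by apply: le_trans (ler_normD _ _) (lerD (step2 _) (step3 _)); lia.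
Qed.

End Chain.

(** * Words as vectors *)

Lemma coord_le_norm (R : realType) n (x : 'rV[R]_n) p : `|x 0 p| <= `|x|.
Proof.
rewrite [leRHS]/Num.norm /= mx_normrE.
by rewrite (le_bigmax 0 (fun ij : 'I_1 * 'I_n => `|x ij.1 ij.2|) (0, p)).
Qed.

Lemma norm_le_coord (R : realType) n (x : 'rV[R]_n) c :
  0 <= c -> (forall p, `|x 0 p| <= c) -> `|x| <= c.
Proof.
move=> c_ge0 xc; rewrite [leLHS]/Num.norm /= mx_normrE; apply/bigmax_leP.
by split=> // -[i p] _; rewrite (ord1 i).
Qed.

Lemma norm1_coord (R : realType) n (x : 'rV[R]_n) :
  `|x| = 1 -> exists p, `|x 0 p| = 1.
Proof.
move=> x1; have [|[i p] /=] := @mx_norm_neq0 R 1 n x.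
  by rewrite -[mx_norm x]/(`|x|) x1 oner_neq0.
by rewrite (ord1 i) -[mx_norm x]/(`|x|) x1 => xp; exists p.
Qed.

Lemma PS_coord_le1 (R : realType) n (Y : {vspace 'rV[R]_n}) x p :
  PS Y x -> 0 <= x 0 p <= 1.
Proof.
case=> _ x_ge0 x1; rewrite x_ge0 -x1.
exact: le_trans (ler_norm _) (coord_le_norm _ _).
Qed.

Lemma PS_dist_le1 (R : realType) n (Y Z : {vspace 'rV[R]_n}) x y :
  PS Y x -> PS Z y -> `|x - y| <= 1.
Proof.
move=> Yx Zy; apply: norm_le_coord => // p; rewrite !mxE ler_norml.
have := PS_coord_le1 p Yx; have := PS_coord_le1 p Zy; lra.
Qed.

Lemma lipschitz_dist (R : realType) n (C : R) (f : 'rV[R]_n -> R) x y :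
  C.-lipschitz_(PS fullv) f -> PS fullv x -> PS fullv y ->
  `|f x - f y| <= C * `|x - y|.
Proof. by move=> lipf Px Py; apply: (lipf (x, y)). Qed.

Lemma PS_sub (R : realType) n (Y : {vspace 'rV[R]_n}) x : PS Y x -> PS fullv x.
Proof. by case=> ? ? ?; split=> //; apply: memvf. Qed.

(* The word [w] placed on the positions [P]: off [P] the index is [size P], so
   the value is the default 0 as long as [size w <= size P]. *)
Definition height (P w : seq nat) (p : nat) : nat := nth 0%N w (index p P).

Lemma size_mask_letters (P w : seq nat) : (size w <= size P)%N ->
  size (mask [seq (0 < a)%N | a <- w] P) = size (letters w).
Proof. by elim: w P => [|[|a] w IHw] [|q P] //= /IHw <-. Qed.

(** A zero letter may be removed together with its position: by uniqueness that position no longer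
    occurs, so it gets the default height 0. *)
Lemma height_letters P w p : uniq P -> (size w <= size P)%N ->
  height P w p = height (mask [seq (0 < a)%N | a <- w] P) (letters w) p.
Proof.
rewrite /height; elim: w P => [|a w IHw] [|q P] //=; first by rewrite !nth_nil.
case/andP=> qP uP; rewrite ltnS => szw.
have [qp|/negPf qp] := eqVneq q p; case: a => [|a] /=; rewrite ?qp ?eqxx //.
  rewrite nth_default // memNindex ?size_mask_letters //.
  by apply: contraNN qP; rewrite qp => /mem_mask.
all: by rewrite /= ?qp /= IHw.
Qed.

Lemma height_catl P Q w p : (size w <= size P)%N ->
  height (P ++ Q) w p = height P w p.
Proof.
move=> szw; rewrite /height index_cat; case: ifP => // /negbT pP.
by rewrite (memNindex pP) !nth_default // (leq_trans szw) ?leq_addr.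
Qed.

Lemma height_nseq P w d p : height P (w ++ nseq d 0%N) p = height P w p.
Proof.
rewrite /height nth_cat nth_nseq; case: ltnP => // szw.
by rewrite nth_default //; case: ifP.
Qed.

Lemma height_le k P w p : all (leq^~ k) w -> (height P w p <= k)%N.
Proof.
move=> wk; rewrite /height; have [szw|szw] := ltnP (index p P) (size w).
  exact: (allP wk _ (mem_nth _ szw)).
by rewrite nth_default.
Qed.

Lemma height_adj_letter P u v p : all2 adj_letter u v ->
  adj_letter (height P u p) (height P v p).
Proof.
rewrite /height; move: (index p P) => i.
elim: u v i => [|a u IHu] [|b v] [|i] //= /andP[ab uv] //; exact: IHu.
Qed.

Section Vectors.
Variables (R : realType) (k : nat) (eta : R).
Hypotheses (k_gt0 : (0 < k)%N) (eta01 : 0 < eta < 1).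

Definition level (a : nat) : R := if a is 0 then 0 else (1 - eta) ^+ (k - a).

Definition vec n (P w : seq nat) : 'rV[R]_n := \row_(p < n) level (height P w p).

Lemma level_itv a : 0 <= level a <= 1.
Proof.
case: a => [|a] /=; first by rewrite lexx ler01.
have /andP[e0 e1] := eta01.
by rewrite exprn_ge0 ?exprn_ile1 ?subr_ge0 ?(ltW e1) // gerBl ltW.
Qed.

Lemma level_top : level k = 1.
Proof. by rewrite /level; case: (k) k_gt0 => //= a _; rewrite subnn. Qed.

Lemma vec_PS n P w : subseq P (iota 0 n) -> (size w <= size P)%N -> k \in w ->
  PS fullv (vec n P w).
Proof.
move=> sP szw kw; split; first exact: memvf.
  by move=> p; rewrite mxE; have /andP[] := level_itv (height P w p).
apply/eqP; rewrite eq_le norm_le_coord ?ler01 //=; last first.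
  by move=> p; rewrite mxE; have /andP[v0 v1] := level_itv (height P w p); rewrite ger0_norm.
have iP : (index k w < size P)%N by apply: leq_trans szw; rewrite index_mem.
have p_lt : (nth 0%N P (index k w) < n)%N.
  by have := mem_subseq sP (mem_nth 0%N iP); rewrite mem_iota.
apply: le_trans (coord_le_norm _ (Ordinal p_lt)).
rewrite mxE /height /= index_uniq ?(subseq_uniq sP) ?iota_uniq //.
by rewrite nth_index // level_top normr1.
Qed.

(** Consecutive nonzero levels x and (1 - eta) x differ by eta x. The step from 0 to 1 is the lowest
    nonzero level (1 - eta)^(k - 1), at most [eta] by assumption. *)
Lemma level_adj_letter a b : (1 - eta) ^+ k.-1 <= eta ->
  (a <= k)%N -> (b <= k)%N -> adj_letter a b -> `|level a - level b| <= eta.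
Proof.
move=> small; wlog le_ab : a b / (a <= b)%N => [wl|].
  case: (leqP a b) => [|/ltnW] ab ak bk adj; first exact: wl.
  by rewrite distrC; apply: wl => //; rewrite /adj_letter andbC.
move=> ak bk /andP[_ ba]; have /andP[e0 e1] := eta01.
move: ba; rewrite leq_eqVlt => /predU1P[eb|]; last first.
  rewrite ltnS => ba; have -> : b = a by apply/eqP; rewrite eqn_leq ba.
  by rewrite subrr normr0 ltW.
rewrite {b}eb distrC in bk le_ab *; case: a ak bk {le_ab} => [|a] ak bk.
  rewrite /= subr0 subn1 ger0_norm // exprn_ge0 // subr_ge0 ltW //.
rewrite /= -(subnSK bk) exprS -[X in `|X - _|]mul1r -mulrBl subKr normrM.
have x0 : 0 <= 1 - eta by rewrite subr_ge0 ltW.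
have x1 : 1 - eta <= 1 by rewrite gerBl ltW.
by rewrite !ger0_norm ?exprn_ge0 ?(ltW e0) // ler_piMr ?(ltW e0) ?exprn_ile1.
Qed.

Lemma vec_close n P u v : (1 - eta) ^+ k.-1 <= eta ->
  all (leq^~ k) u -> all (leq^~ k) v -> all2 adj_letter u v ->
  `|vec n P u - vec n P v| <= eta.
Proof.
move=> small uk vk uv; have /andP[e0 _] := eta01.
apply: norm_le_coord => [|p]; first exact: ltW.
rewrite !mxE; apply: level_adj_letter => //; try exact: height_le.
exact: height_adj_letter.
Qed.

End Vectors.

(** * Sets of positions on which only the nonzero letters matter *)

Lemma truncn_eq_dist (R : realType) (x y : R) : 0 <= x -> 0 <= y ->
  Num.truncn x = Num.truncn y -> `|x - y| <= 1.
Proof.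
move=> /truncn_itv/andP[x1 x2] /truncn_itv/andP[y1 y2] xy.
rewrite -xy -natr1 in y1 y2; rewrite -natr1 in x2.
rewrite ler_norml; lra.
Qed.

(* A [q]-subset is coloured by the approximate values of [f] on all the words
   placed on it.  The last [q] of the [2 * q] homogeneous positions only serve
   to pad shorter words with zeros. *)
Lemma homogeneous_placement (R : realType) (C eta : R) (D k q n : nat)
    (f : 'rV[R]_n -> R) : 0 < C -> (0 < D)%N -> (0 < k)%N -> 0 < eta < 1 ->
    C.-lipschitz_(PS fullv) f ->
    (ramsey_bound ((2 * D).+1 ^ (k.+1 ^ q)) q (2 * q) <= n)%N ->
  exists2 h, subseq h (iota 0 n) & size h = q /\
    forall w w', admissible k q w -> admissible k q w' ->
      letters w = letters w' ->
      `|f (vec k eta n h w) - f (vec k eta n h w')| <= C / D%:R.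
Proof.
move=> C_gt0 D_gt0 k_gt0 eta01 lipf le_n.
pose f0 := f (vec k eta n (iota 0 n) [:: k]).
(* The sphere has diameter at most 1, so f - f0 lies in [-C, C] and the grade in [0, 2D]. Its
   integer part takes 2D + 1 values, each on a range of f of width C / D. *)
pose grade x := (f x - f0 + C) * (D%:R / C).
pose K := {ffun q.-tuple 'I_k.+1 -> 'I_(2 * D).+1}.
pose c (P : seq nat) : K := [ffun z : q.-tuple 'I_k.+1 =>
  inord (Num.truncn (grade (vec k eta n P [seq val a | a <- z])))].
have cardK : #|{: K}| = ((2 * D).+1 ^ (k.+1 ^ q))%N.
  by rewrite card_ffun card_tuple !card_ord.
have K_gt0 : (0 < #|{: K}|)%N by rewrite cardK expn_gt0.
have [|h0 h0n [size_h0 hom]] := @ramsey_seq nat K q (2 * q) K_gt0 c (iota 0 n).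
  by rewrite cardK size_iota.
have size_h : size (take q h0) = q by rewrite size_takel // size_h0; lia.
have DC_gt0 : 0 < D%:R / C by rewrite divr_gt0 ?ltr0n.
exists (take q h0); first exact: subseq_trans (take_subseq _ _) h0n.
split=> // w w' /and3P[wk kw szw] /and3P[w'k kw' szw'] ww'.
pose z := letters w; have z_le : (size z <= q)%N.
  exact: leq_trans (size_letters _) szw.
have kz : k \in z by rewrite mem_letters.
(* Placing [u] on the first [q] positions gives the same vector as placing [z] followed by zeros on
   the [q]-subset [pad u]. So [w] and [w'] become one word on two [q]-subsets. *)
pose pad (u : seq nat) := mask [seq (0 < a)%N | a <- u] (take q h0) ++
   take (q - size z) (drop q h0).
have size_pad u : letters u = z -> (size u <= q)%N -> size (pad u) = q.
  move=> uz szu; rewrite size_cat size_mask_letters ?size_h // uz size_takel.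
    exact: subnKC.
  by rewrite size_drop size_h0; lia.
have sub_pad u : subseq (pad u) h0.
  rewrite -[X in subseq _ X](cat_take_drop q); apply: cat_subseq.
    exact: mask_subseq.
  exact: take_subseq.
have z'P : size [seq inord a : 'I_k.+1 | a <- z ++ nseq (q - size z) 0%N] == q.
  by rewrite size_map size_cat size_nseq subnKC.
have z'E : [seq val a | a <- Tuple z'P] = z ++ nseq (q - size z) 0%N.
  rewrite -map_comp map_id_in // => a; rewrite mem_cat mem_nseq => az /=.
  rewrite inordK // ltnS; case/orP: az => [az|/andP[_ /eqP->] //].
  by have := wk; rewrite -all_letters => /allP/(_ _ az).
have vec_pad u : letters u = z -> (size u <= q)%N ->
    vec k eta n (take q h0) u = vec k eta n (pad u) (z ++ nseq (q - size z) 0%N).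
  move=> uz szu; apply/rowP => p; rewrite !mxE height_nseq.
  rewrite height_catl; last by rewrite size_mask_letters ?size_h // uz.
  rewrite height_letters ?size_h // ?uz //.
  exact: subseq_uniq (subseq_trans (take_subseq _ _) h0n) (iota_uniq _ _).
have pad_PS u : letters u = z -> (size u <= q)%N ->
    PS fullv (vec k eta n (pad u) (z ++ nseq (q - size z) 0%N)).
  move=> uz szu; apply: vec_PS => //.
  - exact: subseq_trans (sub_pad u) h0n.
  - by rewrite size_pad // size_cat size_nseq subnKC.
  - by rewrite mem_cat kz.
have PS0 : PS fullv (vec k eta n (iota 0 n) [:: k]).
  apply: vec_PS => //; last exact: mem_head.
  rewrite size_iota; have := size_subseq h0n; rewrite size_h0 size_iota /=.
  by case: (w) kw szw => //= a l _; lia.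
have grade_itv x : PS fullv x -> 0 <= grade x <= (2 * D)%:R.
  move=> Px; have := lipschitz_dist lipf Px PS0.
  have := PS_dist_le1 Px PS0; rewrite -/f0 => d1 /le_trans/(_ (ler_wpM2l (ltW C_gt0) d1)).
  rewrite mulr1 ler_norml => /andP[fl fu].
  rewrite mulr_ge0 ?(ltW DC_gt0) //=; last by lra.
  apply: (@le_trans _ _ ((C + C) * (D%:R / C))).
    by rewrite ler_wpM2r ?(ltW DC_gt0) // lerD2r.
  by rewrite natrM le_eqVlt; apply/orP; left; apply/eqP; field; apply: lt0r_neq0.
rewrite !vec_pad -?ww' //.
have := hom _ _ (sub_pad w) (sub_pad w').
rewrite !size_pad -?ww' // => /(_ erefl erefl)/ffunP/(_ (Tuple z'P)).
rewrite !ffunE z'E => /(congr1 val) /=.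
have := pad_PS w; have := pad_PS w'; rewrite -ww' => /(_ erefl szw') Px' /(_ erefl szw) Px.
set x := vec _ _ _ _ _ in Px *; set x' := vec _ _ _ _ _ in Px' *.
have /andP[g0 g1] := grade_itv _ Px; have /andP[g0' g1'] := grade_itv _ Px'.
have lt2D y : y <= (2 * D)%:R :> R -> (Num.truncn y < (2 * D).+1)%N.
  by move=> y2D; rewrite ltnS truncn_le_nat (le_lt_trans y2D) // ltr_nat.
rewrite !inordK ?lt2D //.
move=> /(truncn_eq_dist g0 g0').
rewrite /grade -mulrBl normrM (gtr0_norm DC_gt0) -ler_pdivlMr //.
by rewrite mul1r invf_div opprD addrACA subrr addr0 opprB addrA subrK.
Qed.

Lemma nth_flatten_const (T : Type) (x0 : T) (l : nat) (ss : seq (seq T)) i :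
  (0 < l)%N -> all (fun s => size s == l) ss ->
  nth x0 (flatten ss) i = nth x0 (nth [::] ss (i %/ l)) (i %% l).
Proof.
move=> l_gt0; elim: ss i => [|s ss IHss] i /=; first by rewrite !nth_nil.
move=> /andP[/eqP szs /IHss {}IHss]; rewrite nth_cat szs.
case: ltnP => il; first by rewrite divn_small // modn_small.
rewrite IHss -(subnKC il) addKn; set d := (i - l)%N.
by rewrite divnDl ?dvdnn // divnn l_gt0 add1n modnDl.
Qed.

Lemma nth_block (l i idx : nat) (z : seq nat) : (0 < l)%N -> size z = l ->
  nth 0%N (nseq (i * l) 0%N ++ z) idx =
    if (idx %/ l == i)%N then nth 0%N z (idx %% l) else 0%N.
Proof.
move=> l_gt0 szz; rewrite nth_cat size_nseq nth_nseq.
case: ltnP => [lt|ge].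
  by case: eqP => // ei; have := leq_trunc_div idx l; lia.
case: eqP => [ei|ni].
  by congr nth; rewrite -ei {1}(divn_eq idx l) addKn.
rewrite nth_default // szz leqNgt; apply/negP => lt; apply: ni.
have e : idx = (i * l + (idx - i * l))%N by rewrite subnKC.
by rewrite e divnMDl // divn_small // addn0.
Qed.

(** * Rounding of coefficients to levels *)

Section Levels.
Variables (R : realType) (k : nat) (eta : R).
Hypotheses (k_gt0 : (0 < k)%N) (eta01 : 0 < eta < 1).
Hypothesis small : (1 - eta) ^+ k.-1 <= eta.

(** The levels descend from 1 by steps of at most [eta] to a value at most [eta]. The exact rounding
    of 1 is what later provides a factor of height [k]. *)
Lemma level_approx (a : R) : 0 <= a <= 1 ->
  exists g, [/\ (g <= k)%N, `|a - level k eta g| <= eta & a = 1 -> g = k].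
Proof.
have /andP[e0 e1] := eta01; have x0 : 0 <= 1 - eta by rewrite subr_ge0 ltW.
have x1 : 1 - eta <= 1 by rewrite gerBl ltW.
move=> /andP[a0 a1]; have [->|an1] := eqVneq a 1.
  by exists k; rewrite level_top // subrr normr0 ltW.
have [|[i ik ai]] : a <= (1 - eta) ^+ k.-1 \/
    exists2 i, (i < k.-1)%N & `|a - (1 - eta) ^+ i| <= eta.
- elim: k.-1 => [|j [IHj|[i ij ai]]]; first by rewrite expr0; left.
    case: (lerP a ((1 - eta) ^+ j.+1)) => [|lt_a]; first by left.
    right; exists j => //; rewrite distrC ger0_norm ?subr_ge0 //.
    have xj1 : (1 - eta) ^+ j <= 1 by rewrite exprn_ile1.
    have : (1 - eta) ^+ j * eta <= eta by rewrite ler_piMl // ltW.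
    by move: lt_a; rewrite exprSr; lra.
  by right; exists i => //; apply: ltnW.
- move=> /le_trans/(_ small) a_le; exists 0%N; split=> //.
    by rewrite subr0 ger0_norm.
  by move/eqP; rewrite (negPf an1).
exists (k - i)%N; split; first exact: leq_subr.
  rewrite /level; case e : (k - i)%N => [|b]; first by lia.
  by rewrite -e subKn //; lia.
by move/eqP; rewrite (negPf an1).
Qed.

(** The exponents of levels add up, so multiplying by [level g] lowers heights by k - g. One [eta]
    pays for rounding [a], the other for products that fall below the lowest level and are replaced
    by 0. *)
Lemma level_mul (a : R) g b : (g <= k)%N -> (b <= k)%N ->
    `|a - level k eta g| <= eta ->
  `|a * level k eta b - level k eta (b - (k - g))| <= 2 * eta.
Proof.
have /andP[e0 e1] := eta01; have x0 : 0 <= 1 - eta by rewrite subr_ge0 ltW.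
have x1 : 1 - eta <= 1 by rewrite gerBl ltW.
move=> gk bk ag; have /andP[b0 b1] := level_itv k eta01 b.
have prod_le : `|level k eta g * level k eta b - level k eta (b - (k - g))| <= eta.
  case: g gk {ag} => [|g] gk.
    by rewrite mul0r subn0 (eqP bk) subrr normr0 ltW.
  case: b bk {b0 b1} => [|b] bk; first by rewrite mulr0 sub0n subrr normr0 ltW.
  case e : (b.+1 - (k - g.+1))%N => [|c]; rewrite /= -exprD.
    rewrite subr0 ger0_norm ?exprn_ge0 //; apply: le_trans small.
    by apply: ler_wiXn2l => //; lia.
  rewrite (_ : (k - g.+1 + (k - b.+1))%N = (k - c.+1)%N); last by lia.
  by rewrite subrr normr0 ltW.
rewrite (_ : _ - _ = (a - level k eta g) * level k eta b +
  (level k eta g * level k eta b - level k eta (b - (k - g)))); last by ring.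
apply: le_trans (ler_normD _ _) _; rewrite mulr_natl mulr2n.
apply: lerD prod_le; rewrite normrM (ger0_norm b0).
by apply: le_trans ag; rewrite ler_piMr.
Qed.

End Levels.

(** * The block sequence and the oscillation of [f] on its span *)

Section Main.
Variables (R : realType) (C eta : R) (k m n : nat) (f : 'rV[R]_n -> R).
Hypotheses (C_gt0 : 0 < C) (k_gt0 : (0 < k)%N) (eta01 : 0 < eta < 1).
Hypothesis small : (1 - eta) ^+ k.-1 <= eta.
Hypothesis lipf : C.-lipschitz_(PS fullv) f.
Variable h : seq nat.
Hypotheses (h_sub : subseq h (iota 0 n)) (size_h : size h = (2 * (m * 3 ^ k))%N).
Hypothesis hom : forall w w',
  admissible k (2 * (m * 3 ^ k)) w -> admissible k (2 * (m * 3 ^ k)) w' ->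
  letters w = letters w' ->
  `|f (vec k eta n h w) - f (vec k eta n h w')| <= C * eta.

(** Three comparisons of cost C eta: homogeneity from [w] to its padding [u], the Lipschitz
    condition from [u] to [u'], homogeneity from [u'] to [w']. The factor 2 in the number of
    positions makes room for [u]. *)
Lemma hom_wclose w w' : wclose w w' -> admissible k (m * 3 ^ k) w ->
    admissible k (m * 3 ^ k) w' ->
  `|f (vec k eta n h w) - f (vec k eta n h w')| <= 3 * (C * eta).
Proof.
move=> /wclose_padding[u [u' [eu eu' uu' szu]]] /and3P[wk kw szw] /and3P[w'k kw' szw'].
have szuu' : size u' = size u by move: uu'; rewrite all2E => /andP[/eqP].
have adm v v' : letters v = letters v' -> all (leq^~ k) v' -> k \in v' ->
    (size v <= 2 * (m * 3 ^ k))%N -> admissible k (2 * (m * 3 ^ k)) v.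
  move=> vv' v'k kv' szv; rewrite /admissible szv andbT.
  rewrite -all_letters vv' all_letters v'k /=.
  by rewrite -(mem_letters v k_gt0) vv' mem_letters.
have szu2 : (size u <= 2 * (m * 3 ^ k))%N by lia.
have wa : admissible k (2 * (m * 3 ^ k)) w by apply: adm (erefl _) _ _ _ => //; lia.
have wa' : admissible k (2 * (m * 3 ^ k)) w' by apply: adm (erefl _) _ _ _ => //; lia.
have ua := adm _ _ eu wk kw szu2.
have ua' : admissible k (2 * (m * 3 ^ k)) u' by apply: adm eu' _ _ _ => //; rewrite szuu'.
have PSv v : admissible k (2 * (m * 3 ^ k)) v -> PS fullv (vec k eta n h v).
  by case/and3P=> _ kv szv; apply: vec_PS => //; rewrite size_h.
have mid : `|f (vec k eta n h u) - f (vec k eta n h u')| <= C * eta.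
  apply: le_trans (lipschitz_dist lipf (PSv _ ua) (PSv _ ua')) _.
  rewrite ler_pM2l //; apply: vec_close => //.
    by case/and3P: ua.
  by case/and3P: ua'.
have := hom wa ua (esym eu); have := hom ua' wa' eu'.
move: mid; rewrite !ler_norml; lra.
Qed.

Let l := size (zimin k).

Let l_gt0 : (0 < l)%N.
Proof. by have := size_zimin k; rewrite /l -(prednK k_gt0) expnS; have := expn_gt0 3 k.-1; lia. Qed.

Let l_lt : (l < 3 ^ k)%N.
Proof. by rewrite /l size_zimin. Qed.

Definition blocks : m.-tuple 'rV[R]_n :=
  [tuple vec k eta n h (nseq (i * l) 0%N ++ zimin k) | i < m].

Lemma blocksE (i : 'I_m) (p : 'I_n) : tnth blocks i 0 p =
  if (index (p : nat) h %/ l == i)%N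
  then level k eta (nth 0%N (zimin k) (index (p : nat) h %% l)) else 0.
Proof. by rewrite tnth_mktuple mxE /height (nth_block _ _ l_gt0) //; case: ifP. Qed.

Lemma index_blocks (i : 'I_m) : exists2 p : 'I_n,
  index (p : nat) h = (i * l + index k (zimin k))%N & (index k (zimin k) < l)%N.
Proof.
have kl : (index k (zimin k) < l)%N.
  by rewrite index_mem -(prednK k_gt0) zimin_top.
have lt_h : (i * l + index k (zimin k) < size h)%N.
  rewrite size_h; have := ltn_ord i.
  have : (i.+1 * l <= m * l)%N by rewrite leq_mul2r ltn_ord orbT.
  have : (m * l <= m * 3 ^ k)%N by rewrite leq_mul2l ltnW ?orbT.
  by rewrite mulSn; lia.
have p_lt : (nth 0%N h (i * l + index k (zimin k)) < n)%N.
  by have := mem_subseq h_sub (mem_nth 0%N lt_h); rewrite mem_iota.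
exists (Ordinal p_lt) => //=.
by rewrite index_uniq // (subseq_uniq h_sub) // iota_uniq.
Qed.

(** At the position of a letter [k] of block i, a vector of the span shows its i-th coefficient. *)
Lemma level_blocks (i : 'I_m) : exists p : 'I_n,
  forall j, tnth blocks j 0 p = (i == j)%:R.
Proof.
have [p ep kl] := index_blocks i; exists p => j.
rewrite blocksE ep divnMDl // modnMDl divn_small // modn_small // addn0.
rewrite nth_index ?level_top // -?index_mem //.
by case: eqP => [/val_inj->|ij]; rewrite ?eqxx //; case: eqP => // /(congr1 val).
Qed.

Lemma blocks_positive : positive_block_seq blocks.
Proof.
split=> [i|i j ij p q].
  split.
    have [p /(_ i)] := level_blocks i; apply: contra_eq_neq => ->.
    by rewrite mxE eqxx eq_sym oner_neq0.
  move=> p; rewrite blocksE; case: ifP => // _.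
  by have /andP[] := level_itv k eta01 (nth 0%N (zimin k) (index (p : nat) h %% l)).
rewrite !inE !blocksE; case: ifP => [/eqP ip|_]; rewrite ?eqxx // => _.
case: ifP => [/eqP jq|_]; rewrite ?eqxx // => _.
have lt_pq : (index (p : nat) h < index (q : nat) h)%N.
  by rewrite ltnNge; apply/negP => /(leq_div2r l); rewrite ip jq leqNgt ij.
have in_h (s : 'I_n) (u : 'I_m) : (index (s : nat) h %/ l)%N = u -> (s : nat) \in h.
  move=> su; rewrite -index_mem size_h; have := ltn_ord u; rewrite -su ltn_divLR //.
  move/leq_trans; apply.
  have : (m * l <= m * 3 ^ k)%N by rewrite leq_mul2l ltnW ?orbT.
  by lia.
apply: (sorted_ltn_index ltn_trans) lt_pq; rewrite ?(in_h _ _ ip) ?(in_h _ _ jq) //.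
exact: (@subseq_sorted _ ltn ltn_trans _ _ h_sub (iota_ltn_sorted _ _)).
Qed.

(** The constant is 2 for rounding [x] to a word, 1 for deleting its zeros, and 3 times 2m for
    absorbing the factors by [wclose_top]. *)
Lemma block_span_dist x : PS <<blocks>>%VS x ->
  `|f x - f (vec k eta n h (zimin k))| <= (6 * m + 3)%N%:R * (C * eta).
Proof.
move=> Px; have [x_span x_ge0 x1] := Px.
pose a i := coord blocks i x.
have xE p : x 0 p = \sum_i a i * tnth blocks i 0 p.
  rewrite {1}(coord_span x_span) summxE; apply: eq_bigr => i _.
  by rewrite mxE (tnth_nth 0).
have a01 i : 0 <= a i <= 1.
  have [p bp] := level_blocks i; have := PS_coord_le1 p Px.
  rewrite xE (bigD1 i) //= bp eqxx mulr1 big1 ?addr0 // => j ji.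
  by rewrite bp eq_sym (negPf ji) mulr0.
have [g gP] := choice (fun i => level_approx k_gt0 eta01 small (a01 i)).
pose hs := [seq g i | i <- enum 'I_m].
have hsk : all (leq^~ k) hs.
  by apply/allP => _ /mapP[i _ ->]; have [] := gP i.
have size_hs : size hs = m by rewrite size_map size_enum_ord.
have xE1 (p : 'I_n) (i : 'I_m) : (index (p : nat) h %/ l)%N = i ->
    x 0 p = a i * level k eta (nth 0%N (zimin k) (index (p : nat) h %% l)).
  move=> pi; rewrite xE (bigD1 i) //= blocksE pi eqxx big1 ?addr0 // => j ji.
  rewrite blocksE pi; case: eqP => [/val_inj ij|]; last by rewrite mulr0.
  by rewrite ij eqxx in ji.
have xE0 (p : 'I_n) : (m <= index (p : nat) h %/ l)%N -> x 0 p = 0.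
  move=> pm; rewrite xE big1 // => j _; rewrite blocksE.
  by case: eqP => [pj|]; [have := ltn_ord j; lia | rewrite mulr0].
(* Some coordinate of [x] is 1. It is a coefficient times a level, both at most 1, so the
   coefficient is 1 and is rounded to height [k]. *)
have k_hs : k \in hs.
  have [p xp1] := norm1_coord x1.
  have [pm|pm] := ltnP (index (p : nat) h %/ l) m; last first.
    by move: xp1; rewrite xE0 // normr0 => /esym/eqP; rewrite oner_eq0.
  have [_ _ gk] := gP (Ordinal pm); apply/mapP; exists (Ordinal pm).
    by rewrite mem_enum.
  rewrite gk //; move: xp1; rewrite (xE1 _ (Ordinal pm)) // ger0_norm => [e1|]; last first.
    rewrite mulr_ge0 //; first by case/andP: (a01 (Ordinal pm)).
    by case/andP: (level_itv k eta01 (nth 0%N (zimin k) (index (p : nat) h %% l))).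
  have /andP[a0 a1] := a01 (Ordinal pm).
  apply/eqP; rewrite eq_le a1 /= -[leLHS]e1 ler_piMr //.
  by case/andP: (level_itv k eta01 (nth 0%N (zimin k) (index (p : nat) h %% l))).
(* By [level_mul], a coefficient of height [u] lowers its block by k - u; by [letters_shift], what
   remains is [zimin u] up to zeros. *)
pose w := flatten [seq [seq b - (k - u) | b <- zimin k]%N | u <- hs].
have w_letters : letters w = letters (flatten (map zimin hs)).
  rewrite /w; elim: (hs) hsk => //= u s IHs /andP[uk /IHs e].
  by rewrite !letters_cat e letters_zimin -[in zimin k](subnKC uk) letters_shift.
have size_w : size w = (m * l)%N.
  rewrite /w -size_hs; elim: (hs) => //= u s IHs.
  by rewrite size_cat size_map IHs.
have m3k : (m * l <= m * 3 ^ k)%N by rewrite leq_mul2l ltnW ?orbT.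
have k_flat : k \in flatten (map zimin hs).
  apply/flattenP; exists (zimin k); first exact: map_f.
  by rewrite -(prednK k_gt0) zimin_top.
have adm_flat B : (m * 3 ^ k <= B)%N -> admissible k B (flatten (map zimin hs)).
  move=> mB; rewrite /admissible flatten_zimin_leq // k_flat /=.
  by apply: leq_trans (size_flatten_zimin hsk) _; rewrite size_hs.
have adm_w : admissible k (2 * (m * 3 ^ k)) w.
  rewrite /admissible -all_letters w_letters all_letters flatten_zimin_leq //=.
  rewrite -(mem_letters w k_gt0) w_letters mem_letters // k_flat /= size_w; lia.
have x_w : `|x - vec k eta n h w| <= 2 * eta.
  have /andP[e0 _] := eta01.
  apply: norm_le_coord => [|p]; first by rewrite mulr_ge0 // ltW.
  rewrite !mxE /height /w (nth_flatten_const _ _ l_gt0); last first.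
    by apply/allP => _ /mapP[u _ ->]; rewrite size_map.
  have [pm|pm] := ltnP (index (p : nat) h %/ l) m; last first.
    rewrite xE0 // [nth [::] _ _]nth_default; last by rewrite size_map size_hs.
    by rewrite nth_nil subrr normr0 mulr_ge0 // ltW.
  rewrite (xE1 _ (Ordinal pm)) //.
  rewrite (nth_map 0%N) ?size_hs // (nth_map (Ordinal pm)) ?size_enum_ord //.
  rewrite (_ : nth _ (enum 'I_m) _ = Ordinal pm); last first.
    by apply: val_inj; rewrite /= nth_enum_ord.
  rewrite (nth_map 0%N) ?ltn_pmod //.
  have [gk ag _] := gP (Ordinal pm); apply: level_mul => //.
  by apply: (allP (zimin_leq (leqnn k))); rewrite mem_nth // ltn_pmod.
have step1 : `|f x - f (vec k eta n h w)| <= 2 * (C * eta).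
  have Pw : PS fullv (vec k eta n h w).
    by apply: vec_PS; case/and3P: adm_w; rewrite ?size_h.
  apply: le_trans (lipschitz_dist lipf (PS_sub Px) Pw) _.
  by rewrite mulrCA ler_pM2l.
have step2 := hom adm_w (adm_flat _ (@leq_pmull _ 2 isT)) w_letters.
have step3 := @wclose_top _ (fun v => f (vec k eta n h v)) _ _ _ hom_wclose hs k_gt0 hsk k_hs.
rewrite size_hs in step3; move: {step3}(step3 (leqnn _)).
have -> : (6 * m + 3)%N%:R * (C * eta) =
  2 * (C * eta) + C * eta + (3 * (C * eta)) *+ (2 * m).
  rewrite -[_ *+ (2 * m)]mulr_natr natrD !natrM; ring.
move: step1 step2; rewrite !ler_norml; set A := _ *+ _; lra.
Qed.

Lemma osc_blocks : (osc f (PS <<blocks>>%VS) <= ((12 * m + 6)%N%:R * (C * eta))%:E)%E.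
Proof.
apply: ge_ereal_sup => _ [x [y [Px Py ->]]]; rewrite lee_fin.
have -> : (12 * m + 6)%N%:R * (C * eta) =
   (6 * m + 3)%N%:R * (C * eta) + (6 * m + 3)%N%:R * (C * eta).
  rewrite (natrD _ (12 * m)) (natrD _ (6 * m)) !natrM; ring.
have := block_span_dist Px; have := block_span_dist Py.
rewrite !ler_norml; lra.
Qed.

End Main.

(** * Numerical bounds *)

Lemma f3_tower x : f_ 3 x = tower x 1.
Proof.
by apply: eq_iter => y /=; elim: y => //= y ->; rewrite expnS.
Qed.

Lemma exists_minimal_nat (P : nat -> Prop) n : P n ->
  exists2 k, is_minimal_nat P k & (k <= n)%N.
Proof.
move=> Pn; have exP : exists k, `[< P k >] by exists n; apply/asboolP.
exists (ex_minn exP); case: ex_minnP => k /asboolP Pk k_min; last first.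
  by apply: k_min; apply/asboolP.
by split=> // j Pj; apply: k_min; apply/asboolP.
Qed.

(** For the degenerate cases, where [f] already varies by less than [eps] on the whole sphere and
    the standard basis will do. *)
Lemma basis_stable (R : realType) (C eps b : R) m : 0 <= b < eps ->
    (forall (f : 'rV[R]_m -> R) x y, C.-lipschitz_(PS fullv) f -> PS fullv x -> PS fullv y ->
       `|f x - f y| <= b) ->
  osc_stable C eps m m.
Proof.
move=> /andP[b_ge0 b_lt] osc_b f lipf.
exists [tuple delta_mx 0 i | i < m]; split; [split=> [i|i j ij p q]|].
- rewrite tnth_mktuple; split; last by move=> p; rewrite mxE ler0n.
  apply: contra_neq (oner_neq0 R) => /(congr1 (fun x : 'rV_m => x 0 i)).
  by rewrite !mxE !eqxx.
- rewrite !inE !tnth_mktuple !mxE /= !pnatr_eq0 !eqb0 !negbK.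
  by move=> /eqP-> /eqP->.
apply: (@le_lt_trans _ _ b%:E); last by rewrite lte_fin.
apply: ge_ereal_sup => _ [x [y [Px Py ->]]]; rewrite lee_fin.
by apply: osc_b lipf _ _; apply: PS_sub; [apply: Px | apply: Py].
Qed.

(** Each factor 1 - eta pays for one more eta: (1 - eta)(1 + (N + 1) eta) <= 1 + N eta. *)
Lemma bernoulli_inv (R : realType) (eta : R) N : 0 <= eta <= 1 ->
  (1 - eta) ^+ N * (1 + N%:R * eta) <= 1.
Proof.
move=> /andP[e0 e1]; elim: N => [|N IHN]; first by rewrite mul0r addr0 mul1r.
apply: le_trans IHN; rewrite exprSr -mulrA ler_wpM2l ?exprn_ge0 ?subr_ge0 //.
have N0 : 0 <= N%:R :> R by [].
rewrite -natr1; nra.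
Qed.

(** This is the reason for k = D^2: [bernoulli_inv] then has the factor 1 + (D^2 - 1) / D, which is
    at least D. *)
Lemma one_sub_inv_exp_le (R : realType) D : (1 < D)%N ->
  (1 - D%:R^-1 : R) ^+ (D ^ 2).-1 <= D%:R^-1.
Proof.
move=> D_gt1; have D0 : 0 < D%:R :> R by rewrite ltr0n; lia.
have De : D%:R * D%:R^-1 = 1 :> R by rewrite divff // lt0r_neq0.
have D1 : 1 <= D%:R :> R by rewrite ler1n; lia.
have eta01 : 0 <= (D%:R^-1 : R) <= 1 by rewrite invr_ge0 ltW //= invf_le1.
have := bernoulli_inv (D ^ 2).-1 eta01.
have -> : ((D ^ 2).-1)%:R = D%:R * D%:R - 1 :> R.
  by rewrite -natrM mulnn -subn1 natrB // expn_gt0; lia.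
have -> : 1 + (D%:R * D%:R - 1) * D%:R^-1 = D%:R + (1 - D%:R^-1) :> R.
  by rewrite mulrBl mul1r -mulrA De mulr1; lra.
set x := (_ ^+ _) => x_le.
have x0 : 0 <= x by apply: exprn_ge0; case/andP: eta01; lra.
rewrite -[leRHS]mul1r ler_pdivlMr //; apply: le_trans x_le.
by apply: ler_wpM2l => //; case/andP: eta01; lra.
Qed.

Lemma main_stable (R : realType) (C eps : R) (D m n : nat) : 0 < C -> (1 < D)%N ->
    (12 * m + 6)%N%:R * (C / D%:R) < eps ->
    (ramsey_bound ((2 * D).+1 ^ ((D ^ 2).+1 ^ (2 * (m * 3 ^ (D ^ 2)))))
       (2 * (m * 3 ^ (D ^ 2))) (2 * (2 * (m * 3 ^ (D ^ 2)))) <= n)%N ->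
  osc_stable C eps m n.
Proof.
move=> C_gt0 D_gt1 lt_eps; set k := (D ^ 2)%N => le_n f lipf.
have D_gt0 : (0 < D)%N by lia.
have k_gt0 : (0 < k)%N by rewrite expn_gt0; lia.
have eta01 : 0 < (D%:R^-1 : R) < 1.
  by rewrite invr_gt0 ltr0n D_gt0 invf_lt1 ?ltr1n ?ltr0n.
have small := one_sub_inv_exp_le R D_gt1.
have [h h_sub [size_h hom]] := homogeneous_placement C_gt0 D_gt0 k_gt0 eta01 lipf le_n.
exists (blocks D%:R^-1 k m n h); split; first exact: blocks_positive.
apply: le_lt_trans (osc_blocks C_gt0 k_gt0 eta01 small lipf h_sub size_h hom) _.
by rewrite lte_fin.
Qed.

(** The height is 3q from [ramsey_bound_le], plus 1 for bounding the base by 2^(2D + kq + 2q + 1),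
    plus that exponent itself, turned into a tower over 1. *)
Lemma ramsey_height (D k q : nat) : (0 < q)%N -> (0 < D)%N ->
  (ramsey_bound ((2 * D).+1 ^ (k.+1 ^ q)) q (2 * q)
     <= tower (2 * D + (k + 5) * q + 2) 1)%N.
Proof.
move=> q_gt0 D_gt0; pose b := ((2 * D).+1 * k.+1 ^ q)%N.
have kappa : (1 < (2 * D).+1 ^ (k.+1 ^ q) <= 2 ^ b)%N.
  have D2 : (1 < (2 * D).+1)%N by lia.
  rewrite -{1}(exp1n (k.+1 ^ q)) ltn_exp2r ?expn_gt0 // D2 /=.
  by rewrite expnM leq_exp2r ?expn_gt0 //; apply/ltnW/ltn_expl.
apply: leq_trans (ramsey_bound_le q _ kappa) _.
have le_b : (b <= 2 ^ (2 * D + k * q))%N.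
  rewrite expnD; apply: leq_mul; first exact: ltn_expl.
  by rewrite expnM leq_exp2r //; apply: ltn_expl.
have le_q : (2 * q < 2 ^ (2 * q))%N by apply: ltn_expl.
have le_base : ((2 * q + b).+1 <= 2 ^ (2 * D + k * q + 2 * q).+1)%N.
  rewrite expnS [(2 * 2 ^ _)%N]mul2n -addnn -addSn; apply: leq_add.
    by apply: leq_trans le_q _; rewrite leq_exp2l // leq_addl.
  by apply: leq_trans le_b _; rewrite leq_exp2l // leq_addr.
apply: leq_trans (leq_tower (3 * q) le_base) _.
rewrite -[X in (X <= _)%N]/(iter (3 * q) (expn 2) (iter 1 (expn 2) (2 * D + k * q + 2 * q).+1)).
rewrite -iterD -/(tower _ _); apply: leq_trans (tower1_ge _ _) _.
by apply: leq_tower1; lia.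
Qed.

Lemma square_le_exp3 r : (9 <= r)%N -> (12 * r ^ 2 + 3 <= 3 ^ r)%N.
Proof.
elim: r => // r IHr; rewrite leq_eqVlt => /predU1P[<-|]; first by vm_compute.
by rewrite ltnS => /[dup] r9 /IHr; rewrite [(3 ^ r.+1)%N]expnS -!mulnn; nia.
Qed.

(** With X = 3^k the left side is below 27 X^3 = 3^(3k + 3), because m and k are less than X.
    Moreover 3k + 3 = 12 m^2 r^2 + 3 <= m^2 3^r <= m^(r + 2). *)
Lemma height_lt_exp (m r : nat) : (3 <= m)%N -> (9 <= r)%N ->
  let D := (2 * (m * r))%N in
  (2 * D + (D ^ 2 + 5) * (2 * (m * 3 ^ (D ^ 2))) + 2 < 9 ^ (m ^ (r + 2)))%N.
Proof.
move=> m3 r9 /=; set D := (2 * (m * r))%N; set k := (D ^ 2)%N.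
have D_gt0 : (0 < D)%N by rewrite !muln_gt0; lia.
have le_Dk : (D <= k)%N by rewrite /k -mulnn leq_pmulr.
have le_mk : (m <= k)%N by apply: leq_trans le_Dk; rewrite /D; nia.
have lt_k : (k < 3 ^ k)%N by apply: ltn_expl.
have le_exp : (3 * k + 3 <= 2 * m ^ (r + 2))%N.
  have -> : k = (4 * m ^ 2 * r ^ 2)%N by rewrite /k /D !expnMn mulnA.
  have mr : (3 ^ r <= m ^ r)%N by rewrite leq_exp2r //; lia.
  have := square_le_exp3 r9; rewrite expnD.
  have m2 : (0 < m ^ 2)%N by rewrite expn_gt0; lia.
  move: (m ^ 2)%N (r ^ 2)%N (m ^ r)%N (3 ^ r)%N mr m2 => a b c d.
  nia.
apply: (@leq_trans (3 ^ (3 * k + 3))); last first.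
  by rewrite -[9%N]/(3 ^ 2)%N -expnM leq_exp2l.
rewrite expnD mulnC expnM -[(3 ^ 3)%N]/27%N.
rewrite (_ : ((3 ^ 3) ^ k)%N = (3 ^ k * (3 ^ k * 3 ^ k))%N); last first.
  by rewrite -expnM -!expnD; congr expn; lia.
move: (3 ^ k)%N lt_k => X lt_k.
have h1 : (m * X <= X * X)%N by rewrite leq_mul2r; apply/orP; right; lia.
have h2 : ((k + 5) * (2 * (m * X)) <= (5 * X) * (2 * (X * X)))%N.
  by apply: leq_mul; [lia | rewrite leq_mul2l h1 orbT].
have h3 : (X <= X * (X * X))%N by rewrite leq_pmulr // muln_gt0; lia.
have h4 : ((5 * X) * (2 * (X * X)) = 10 * (X * (X * X)))%N by lia.
lia.
Qed.

Lemma le_nceil (R : realType) (x : R) : 0 <= x -> x <= (nceil x)%:R.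
Proof.
move=> x0; rewrite /nceil natr_absz ger0_norm; first exact: Num.Theory.ceil_ge.
by rewrite -(ceil0 R) ceil_le.
Qed.

Lemma nceil_le (R : realType) (x y : R) : 0 <= x -> x <= y ->
  (nceil x <= nceil y)%N.
Proof.
move=> x0 xy; have c0 : 0 <= Num.ceil x by rewrite -(ceil0 R) ceil_le.
by have := ceil_le xy; rewrite /nceil; lia.
Qed.

Lemma nceil_gt0 (R : realType) (x : R) : 0 < x -> (0 < nceil x)%N.
Proof.
move=> x0; rewrite -(ltr0n R); apply: lt_le_trans x0 (le_nceil (ltW x0)).
Qed.

(** Since delta <= 1/12, ln delta <= -11/12 and -ln(1 - delta) <= delta / (1 - delta), so the
    quotient of logarithms is at least (11/12)^2 / delta, which exceeds (3/4) / delta = 9C / eps. *)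
Lemma le_s_of (R : realType) (C eps : R) : 0 < eps -> eps <= C ->
  (nceil (9 * C / eps) + 2 <= s_of C eps)%N.
Proof.
move=> eps0 epsC; have C0 : 0 < C := lt_le_trans eps0 epsC.
rewrite /s_of leq_add2r; set delta := eps / (12 * C).
have d0 : 0 < delta by rewrite divr_gt0 // mulr_gt0.
have d1 : delta <= 12%:R^-1.
  by rewrite /delta ler_pdivrMr ?mulr_gt0 //; lra.
have -> : 9 * C / eps = (3 / 4) / delta.
  by rewrite /delta; field; rewrite ?lt0r_neq0.
apply: nceil_le; first by rewrite divr_ge0 // ltW.
have ln_delta : ln delta <= - (11 / 12).
  rewrite (_ : delta = 1 + (delta - 1)); last by ring.
  by apply: le_trans (le_ln1Dx _) _; lra.
have u0 : 0 < 1 - delta by lra.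
have ln_u : - (delta / (1 - delta)) <= ln (1 - delta).
  rewrite lerNl -lnV ?posrE //.
  have e : (1 - delta)^-1 = 1 + delta / (1 - delta) by field; rewrite lt0r_neq0.
  rewrite [X in ln X]e.
  by apply: le_ln1Dx; apply: lt_trans (divr_gt0 d0 u0); lra.
have ln_u0 : ln (1 - delta) < 0 by apply: ln_lt0; lra.
rewrite ler_ndivlMr //; apply: le_trans ln_delta _.
have c0 : 0 <= 3 / 4 / delta by rewrite divr_ge0 // ltW.
apply: le_trans (ler_wpM2l c0 ln_u).
rewrite [leRHS](_ : _ = - (3 / 4 / (1 - delta))); last first.
  by field; rewrite !lt0r_neq0.
by rewrite lerN2 ler_pdivrMr //; lra.
Qed.

Theorem mainTheorem3 (R : realType) (C eps : R) (t : nat)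
  (C_gt0 : 0 < C) (eps_gt0 : 0 < eps) (eps_lt9 : eps < 9) :
  let s := s_of C eps in
  exists n : nat,
    is_minimal_nat (osc_stable C eps (3 ^ t)) n /\
    (n < f_ 3 (3 ^ (t * s) * nceil (9 * C / eps) ^ (3 ^ (t * s))
               * nceil (log2 (9 / eps))))%N.
Proof.
move=> s; set r := nceil (9 * C / eps); set L := nceil (log2 _).
have r_gt0 : (0 < r)%N by rewrite nceil_gt0 // divr_gt0 // mulr_gt0.
(* Here eps < 9 makes the logarithm positive, so that [H] below dominates each of its factors. *)
have L_gt0 : (0 < L)%N.
  by rewrite nceil_gt0 // divr_gt0 // ln_gt0 // ?ltr1n // ltr_pdivlMr // mul1r.
suff [n n_stable n_lt] : exists2 n, osc_stable C eps (3 ^ t) n &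
    (n < f_ 3 (3 ^ (t * s) * r ^ (3 ^ (t * s)) * L))%N.
  have [k k_min kn] := exists_minimal_nat n_stable.
  by exists k; split=> //; apply: leq_ltn_trans n_lt.
rewrite f3_tower; set H := (_ * L)%N.
have le_H1 : (3 ^ (t * s) <= H)%N.
  by rewrite /H -mulnA leq_pmulr // muln_gt0 expn_gt0 r_gt0.
have le_H2 : (r ^ (3 ^ (t * s)) <= H)%N.
  by rewrite /H mulnAC leq_pmull // muln_gt0 expn_gt0.
have le_H3 : (3 ^ t <= H)%N.
  apply: leq_trans le_H1; rewrite leq_exp2l // leq_pmulr //.
  by rewrite /s /s_of addn2.
have trivial b : 0 <= b < eps ->
    (forall (f : 'rV[R]_(3 ^ t) -> R) x y, C.-lipschitz_(PS fullv) f ->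
       PS fullv x -> PS fullv y -> `|f x - f y| <= b) ->
    exists2 n, osc_stable C eps (3 ^ t) n & (n < tower H 1)%N.
  move=> b_lt osc_b; exists (3 ^ t)%N; first exact: basis_stable b_lt osc_b.
  exact: leq_ltn_trans le_H3 (tower1_gt H).
have [C_lt|eps_C] := ltP C eps.
  apply: (trivial C); first by rewrite C_lt ltW.
  move=> f x y lipf Px Py; apply: le_trans (lipschitz_dist lipf Px Py) _.
  by rewrite ler_piMr ?(ltW C_gt0) // (PS_dist_le1 Px Py).
(* For t = 0 the positive sphere is a single point. *)
have [t0|t_gt0] := posnP t.
  apply: (trivial 0); first by rewrite lexx.
  move=> f x y _ Px Py; rewrite (_ : x = y) ?subrr ?normr0 //.
  have p0 (p p' : 'I_(3 ^ t)) : p = p'.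
    by apply: val_inj; case: p p' => [p pl] [p' pl'] /=; rewrite t0 in pl pl'; lia.
  have one (z : 'rV[R]_(3 ^ t)) p : PS fullv z -> z 0 p = 1.
    case=> _ z0 /norm1_coord[p']; rewrite (p0 p' p) ger0_norm //.
  by apply/rowP => p; rewrite !one.
have r9 : (9 <= r)%N.
  rewrite -(ler_nat R); apply: le_trans (le_nceil _); last by rewrite divr_ge0 ?mulr_ge0 ?ltW.
  by rewrite ler_pdivlMr // ler_pM2l.
set m := (3 ^ t)%N; have m3 : (3 <= m)%N by rewrite -[X in (X <= _)%N]expn1 leq_exp2l.
(* As r eps >= 9C, D eps >= 18 m C, while 12m + 6 <= 14m by m >= 3; hence (12m + 6) C / D < eps. *)
pose D := (2 * (m * r))%N.
have D_gt1 : (1 < D)%N by rewrite /D; nia.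
exists (ramsey_bound ((2 * D).+1 ^ ((D ^ 2).+1 ^ (2 * (m * 3 ^ (D ^ 2)))))
       (2 * (m * 3 ^ (D ^ 2))) (2 * (2 * (m * 3 ^ (D ^ 2)))))%N.
  apply: (@main_stable _ _ _ D) => //.
  have m0 : 3 <= m%:R :> R by rewrite ler_nat.
  have r0 : 9 * C <= r%:R * eps.
    by rewrite -ler_pdivrMr // le_nceil // divr_ge0 ?mulr_ge0 ?ltW.
  have D0 : 0 < D%:R :> R by rewrite ltr0n; lia.
  rewrite mulrA ltr_pdivrMr // /D natrD !natrM.
  have : 9 * C * m%:R <= r%:R * eps * m%:R by rewrite ler_wpM2r.
  have : 3 * C <= m%:R * C by rewrite ler_wpM2r // ltW.
  have : 0 < C * m%:R by rewrite mulr_gt0 // ltr0n expn_gt0.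
  nra.
apply: leq_ltn_trans (ramsey_height _ _ _) _; first by rewrite !muln_gt0 !expn_gt0.
  by lia.
apply: ltn_tower1; apply: leq_trans (height_lt_exp m3 r9) _.
(* The exponents compare by s >= r + 2, the bases by r >= 9. *)
apply: leq_trans le_H2; apply: leq_trans (_ : 9 ^ (3 ^ (t * s)) <= _)%N; last first.
  by rewrite leq_exp2r ?expn_gt0.
rewrite leq_exp2l // expnM leq_exp2l; last by lia.
exact: le_s_of.
Qed.
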